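(* On instances with a uniform deadline (i.e. $d_j=d$ for all jobs $j$), LLF is $1$-competitive for preemptive semi-online machine minimization; that is, LLF run on $m$ machines produces a feasible schedule, where $m$ is the optimal number of machines.
   Context: Machine minimization with deadlines: each job $j$ of a finite instance has integer release date $r_j$, processing time $p_j$ and deadline $d_j$. A feasible preemptive schedule on a given number of identical machines processes each job for $p_j$ units within $[r_j,d_j]$, each machine processing at most one job at a time, no job on two machines at once; preemption and migration allowed. $m$ is the minimum number of machines admitting a feasible schedule. Semi-online: jobs become known at their release dates and $m$ is known in advance. For an algorithm, $p_j(t)$ is the remaining processing time of $j$ at time $t$ and its laxity is $\ell_j(t)=d_j-t-p_j(t)$. Least Laxity First (LLF) on $k$ machines makes decisions at integer times and at each time processes the $k$ released, unfinished jobs with smallest non-negative laxity, ties broken in favor of earlier release date, then smaller index. *)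

(* Defs.v *)
From mathcomp Require Import all_boot all_order all_algebra.
From mathcomp Require Import all_classical all_reals all_analysis.

Set Implicit Arguments.
Unset Strict Implicit.
Unset Printing Implicit Defensive.

Import Order.TTheory GRing.Theory Num.Theory.
Local Open Scope classical_set_scope.
Local Open Scope ring_scope.

Record instance := Instance {
  njobs : nat;
  release : 'I_njobs -> int;
  proc : 'I_njobs -> nat;
  deadline : 'I_njobs -> int }.

(* [s i x] is the job processed by machine [i] at real time [x], if any, so a
   machine processes at most one job at a time by construction.  Preemption
   and migration may occur at arbitrary real times. *)
Definition schedule (R : realType) (I : instance) (k : nat) :=
  'I_k -> R -> option 'I_(njobs I).

Definition feasible (R : realType) (I : instance) (k : nat)
    (s : schedule R I k) : Prop :=
  [/\ forall i j, measurable [set x : measurableTypeR R | s i x = Some j],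
      forall i1 i2 x j, s i1 x = Some j -> s i2 x = Some j -> i1 = i2,
      forall i x j, s i x = Some j ->
        (release j)%:~R <= x <= (deadline j)%:~R &
      forall j, lebesgue_measure [set x : R | exists i, s i x = Some j]
                = ((proc j)%:R)%:E].

Definition optimal_machines (R : realType) (I : instance) (m : nat) : Prop :=
  (exists s : schedule R I m, feasible s) /\
  (forall k (s : schedule R I k), feasible s -> (m <= k)%N).

Section LeastLaxityFirst.
Variables (I : instance) (k : nat).
Implicit Types (t : int) (rem : 'I_(njobs I) -> nat).

Definition laxity t rem (j : 'I_(njobs I)) : int :=
  deadline j - t - (rem j)%:Z.

Definition llf_le t rem (i j : 'I_(njobs I)) : bool :=
  (laxity t rem i < laxity t rem j) ||
  ((laxity t rem i == laxity t rem j) &&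
   ((release i < release j) ||
    ((release i == release j) && (i <= j)%N))).

(* The at most [k] jobs processed during the slot [t, t+1), by priority, when
   [rem] gives the remaining processing times at time [t]. *)
Definition llf_pick t rem : seq 'I_(njobs I) :=
  take k (sort (llf_le t rem)
    [seq j <- enum 'I_(njobs I) |
      [&& release j <= t, (0 < rem j)%N & 0 <= laxity t rem j]]).

(* Only a lower bound on the release dates matters here: no job is processed
   before the first release, so any such bound gives the same run. *)
Definition llf_start : int := \big[Num.min/0]_(j < njobs I) release j.

Fixpoint llf_iter (u : nat) : 'I_(njobs I) -> nat :=
  if u is u'.+1 then
    fun j => (llf_iter u' j
              - (j \in llf_pick (llf_start + u'%:Z) (llf_iter u')))%N
  else @proc I.

Definition llf_rem t : 'I_(njobs I) -> nat :=
  if t - llf_start is Posz u then llf_iter u else @proc I.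

(* The job in position [i] of the slot's priority list runs on machine [i]. *)
Definition llf_schedule (R : realType) : schedule R I k :=
  fun i x => let t := Num.floor x in onth (llf_pick t (llf_rem t)) i.

End LeastLaxityFirst.

(* Main.v *)
(* With a uniform deadline, least laxity means longest remaining work.  For a
   set T of unit slots, any feasible schedule processes job j for at least
   (p_j - |[r_j, d) minus T|)^+ inside T, so these quantities add up to at most
   m|T|.  If LLF on m machines lets a laxity become negative, this inequality
   fails for the remaining work at that time with T empty.  Going back slot by
   slot, the violation persists: either LLF runs m jobs that all need T, and the
   slot is added to T, or LLF runs every released job that needs T, and the slot
   is left out.  At the start this contradicts the feasibility of m machines. *)
Require Import Defs.
From mathcomp Require Import all_boot all_order all_algebra.
From mathcomp Require Import all_classical all_reals all_analysis.
From mathcomp Require Import zify.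

Set Implicit Arguments.
Unset Strict Implicit.
Unset Printing Implicit Defensive.

Import Order.TTheory GRing.Theory Num.Theory.
Local Open Scope ring_scope.

Lemma llf_start_le (I : instance) (j : 'I_(njobs I)) :
  llf_start I <= release j.
Proof. exact: bigmin_le_cond. Qed.

(** * Priority lists of LLF *)

Section Pick.
Variables (I : instance) (k : nat).
Implicit Types (t : int) (rem : 'I_(njobs I) -> nat) (i j : 'I_(njobs I)).

Lemma llf_le_total t rem : total (llf_le t rem).
Proof. by move=> i j; rewrite /llf_le; lia. Qed.

Lemma llf_le_trans t rem : transitive (llf_le t rem).
Proof. by move=> i j l; rewrite /llf_le; lia. Qed.

Definition eligible t rem j :=
  [&& release j <= t, (0 < rem j)%N & 0 <= laxity t rem j].

Lemma llf_pick_eligible t rem j : j \in llf_pick k t rem -> eligible t rem j.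
Proof. by move/mem_take; rewrite mem_sort mem_filter => /andP[]. Qed.

Lemma llf_pick_uniq t rem : uniq (llf_pick k t rem).
Proof. by rewrite take_uniq // sort_uniq filter_uniq // enum_uniq. Qed.

Lemma llf_pick_size t rem : (size (llf_pick k t rem) <= k)%N.
Proof. by rewrite size_take; case: ltnP. Qed.

(** A rejected eligible job lies in the dropped tail of the sorted list, so the prefix has full
    length and its members all precede that job. *)
Lemma llf_pick_full t rem j : eligible t rem j -> j \notin llf_pick k t rem ->
  size (llf_pick k t rem) = k /\
  forall i, i \in llf_pick k t rem -> laxity t rem i <= laxity t rem j.
Proof.
move=> ej; rewrite /llf_pick; set s := sort _ _ => jNs.
have js : j \in s by rewrite mem_sort mem_filter mem_enum andbT.
have jd : j \in drop k s.
  by move: js; rewrite -{1}(cat_take_drop k s) mem_cat (negPf jNs).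
split.
  rewrite size_takel // leqNgt; apply/negP => lt_sk.
  by move: jd; rewrite drop_oversize // ltnW.
move=> i it; have : sorted (llf_le t rem) s.
  by apply: sort_sorted; exact: llf_le_total.
rewrite (sorted_pairwise (@llf_le_trans t rem)) -{1}(cat_take_drop k s).
rewrite pairwise_cat => /andP[/allrelP/(_ i j it jd) + _].
by rewrite /llf_le; lia.
Qed.

End Pick.

(** * Overload and its backward propagation *)

Section Overload.
Variables (I : instance) (k : nat) (d : int).
Hypothesis deadline_d : forall j : 'I_(njobs I), deadline j = d.
Implicit Types (j : 'I_(njobs I)) (T : nat -> bool) (u v : nat).

Let a := llf_start I.

Definition horizon : nat := `|(Num.max 0 (d - a))%R|%N.
Let n := horizon.

Definition slots_outside T v j : nat :=
  \sum_(v <= u < n) (~~ T u && (release j <= a + u%:Z)%R : nat).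

(* In state [llf_iter k v], job [j] can receive at most [slots_outside T v j]
   units outside the slots of [T], so the truncated difference is a lower bound
   on its work inside [T]. *)
Definition overload T v : Prop :=
  (k * \sum_(v <= u < n) (T u : nat)
     < \sum_(j < njobs I) (llf_iter k v j - slots_outside T v j))%N.

Lemma horizonE u : (u < n)%N -> d = a + n%:Z.
Proof. by rewrite /n /horizon; lia. Qed.

Lemma laxity_slot u j : (u < n)%N ->
  laxity (a + u%:Z) (llf_iter k u) j = n%:Z - u%:Z - (llf_iter k u j)%:Z.
Proof. by move=> un; rewrite /laxity deadline_d (horizonE un); lia. Qed.

(** The bound on remaining work says that no laxity is negative at slot [v], so every released
    unfinished job still competes there. *)
Lemma overload_step T v : (v < n)%N ->
  (forall j, llf_iter k v j <= n - v)%N ->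
  overload T v.+1 -> exists T', overload T' v.
Proof.
move=> vn lax_ge0; rewrite /overload => ov.
pose T' b u := if u == v then b else T u.
have sumT' b : (\sum_(v <= u < n) (T' b u : nat)
                = b + \sum_(v.+1 <= u < n) (T u : nat))%N.
  rewrite big_ltn // /T' eqxx; congr (_ + _)%N.
  by apply: eq_big_nat => u /andP[vu _]; rewrite gtn_eqF.
have outT' b j : slots_outside (T' b) v j
    = ((~~ b && (release j <= a + v%:Z)%R) + slots_outside T v.+1 j)%N.
  rewrite /slots_outside big_ltn // /T' eqxx; congr (_ + _)%N.
  by apply: eq_big_nat => u /andP[vu _]; rewrite gtn_eqF.
(* By the uniform deadline, all jobs released by slot [v] share the same later slots outside [T].
   Hence [c] is a common threshold for needing [T]. *)
pose c := (\sum_(v.+1 <= u < n) (~~ T u : nat))%N.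
have outE j : release j <= a + v%:Z -> slots_outside T v.+1 j = c.
  move=> rj; apply: eq_big_nat => u /andP[vu _]; case: (T u) => //=.
  by have -> : release j <= a + u%:Z by lia.
pose q := llf_pick k (a + v%:Z) (@llf_iter I k v).
have q_released j : j \in q -> release j <= a + v%:Z.
  by move/llf_pick_eligible => /and3P[].
have iterS j : llf_iter k v.+1 j = (llf_iter k v j - (j \in q))%N by [].
have [/andP[/eqP qk /allP q_gt]|notA] :=
    boolP ((size q == k) && all (fun j => c < llf_iter k v j)%N q).
- (* All machines work on jobs that need the slots of [T]: adding slot [v] to
     [T] raises both sides by [k]. *)
  exists (T' true); rewrite sumT' mulnDr muln1.
  have sumq : (\sum_(j < njobs I) (j \in q : nat))%N = k.
    rewrite -qk -(card_uniqP (llf_pick_uniq _ _ _)) -sum1_card.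
    rewrite [RHS]big_mkcond /=.
    by apply: eq_bigr => j _; case: ifP.
  rewrite -[X in (X + _)%N]sumq addnC.
  apply: (@leq_trans (\sum_(j < njobs I)
     ((llf_iter k v.+1 j - slots_outside T v.+1 j) + (j \in q))))%N.
    by rewrite big_split /= -addSn leq_add2r.
  apply: leq_sum => j _; rewrite outT' iterS /= add0n.
  case: (boolP (j \in q)) => jq /=; last by lia.
  by rewrite outE ?q_released //; have := q_gt j jq; lia.
- (* Otherwise LLF runs every released job that needs the slots of [T], and
     leaving slot [v] out of [T] keeps both sides. *)
  have busy j : release j <= a + v%:Z -> (c < llf_iter k v j)%N -> j \in q.
    move=> rj cj; apply: contraT => jNq; case/negP: notA.
    have ej : eligible (a + v%:Z) (llf_iter k v) j.
      rewrite /eligible rj laxity_slot //=; have := lax_ge0 j; lia.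
    (* If [j] were rejected, every job of [q] would have at least as much work left as [j], hence
       more than [c]. *)
    have [-> q_le] := llf_pick_full ej jNq; rewrite eqxx /=.
    by apply/allP => i /q_le; rewrite !laxity_slot //; lia.
  exists (T' false); rewrite sumT' add0n (leq_trans ov) // leq_sum // => j _.
  rewrite outT' iterS /=; case: (boolP (release j <= a + v%:Z)) => rj /=.
    (* A picked job loses one unit of work and one slot outside [T' false]; an unpicked one has at
       most [c] units left, so its term after slot [v] is zero. *)
    have := busy j rj; rewrite outE //.
    by case: (j \in q) => //= H; [lia|have := H; lia].
  by rewrite add0n leq_sub2r // leq_subr.
Qed.

Hypothesis cut : forall T, ~ overload T 0.

(** At a first violation the empty [T] is overloaded. The bounds at earlier slots let
    [overload_step] carry an overload back to slot 0, against [cut]. *)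
Lemma llf_iter_le u j : (u <= n)%N -> (llf_iter k u j <= n - u)%N.
Proof.
elim/ltn_ind: u j => u IHu j un; rewrite leqNgt; apply/negP => late.
have [T ov] : exists T, overload T u.
  exists (fun=> false); rewrite /overload big1 // muln0 (bigD1 j) //= addn_gt0.
  rewrite subn_gt0 (leq_ltn_trans _ late) // /slots_outside.
  rewrite -[(n - u)%N]muln1 -sum_nat_const_nat.
  by apply: leq_sum => w _; case: (_ && _).
suff: forall v T, (v <= u)%N -> overload T v -> exists T', overload T' 0.
  by move=> /(_ u T (leqnn u) ov)[T' /cut].
elim=> [T' _ ?|v IHv T' vu ov']; first by exists T'.
have [|T'' ov''] := overload_step (leq_trans vu un) _ ov'.
  by move=> i; apply: IHu => //; lia.
by apply: IHv ov''; lia.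
Qed.

Lemma llf_iter_horizon j : llf_iter k n j = 0%N.
Proof. by apply/eqP; rewrite -leqn0 -(subnn n) llf_iter_le. Qed.

End Overload.

(** * Measure of unions of unit slots *)

Section Slots.
Variable R : realType.
Local Open Scope classical_set_scope.
Local Notation mu := (@lebesgue_measure R).

Lemma slotE (z : int) :
  [set x : R | Num.floor x = z] = `[z%:~R, (z + 1)%:~R[.
Proof.
apply/seteqP; split=> x /=; rewrite in_itv /=.
  by move=> <-; exact: floor_itv.
by rewrite -floor_eq => /eqP.
Qed.

Lemma measurable_floor_preimage (P : set int) :
  measurable [set x : measurableTypeR R | P (Num.floor x)].
Proof.
have -> : [set x : measurableTypeR R | P (Num.floor x)]
    = \bigcup_z ([set x | Num.floor x = z] `&` [set _ | P z]).
  apply/seteqP; split=> [x Px|x [z _ [/= xz Pz]]]; last by rewrite /= xz.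
  by exists (Num.floor x).
apply: countable_bigcupT_measurable => [|z]; first exact: countableP.
have [Pz|nPz] := pselect (P z).
  rewrite (_ : [set _ | P z] = setT) ?setIT ?slotE; first exact: measurable_itv.
  by apply/seteqP; split.
by rewrite (_ : [set _ | P z] = set0) ?setI0 //; apply/seteqP; split.
Qed.

Definition slots (a : int) (n : nat) (B : nat -> bool) : set int :=
  [set z | exists u, [/\ (u < n)%N, B u & z = a + u%:Z]].

Lemma measure_slots (a : int) (n : nat) (B : nat -> bool) :
  mu [set x | slots a n B (Num.floor x)]
    = ((\sum_(0 <= u < n) (B u : nat))%N%:R)%:E.
Proof.
elim: n => [|n IHn].
  rewrite big_nil [X in mu X](_ : _ = set0) ?measure0 //.
  by apply/seteqP; split=> x // [u []].
pose top := [set z : int | B n /\ z = a + n%:Z].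
have -> : [set x : R | slots a n.+1 B (Num.floor x)] =
    [set x | slots a n B (Num.floor x)] `|` [set x | top (Num.floor x)].
  apply/seteqP; split=> x.
    case=> u []; rewrite ltnS leq_eqVlt => /orP[/eqP->|un] Bu xu.
      by right.
    by left; exists u.
  case=> [[u [un Bu xu]]|[Bn xn]]; last by exists n.
  by exists u; split=> //; rewrite ltnS ltnW.
rewrite measureU; [|exact: measurable_floor_preimage..|]; last first.
  by apply/seteqP; split=> x // [[u [un _ xu]] [_]]; rewrite xu; lia.
rewrite big_nat_recr //= natrD EFinD; congr (_ + _)%E; first exact: IHn.
case: (boolP (B n)) => Bn.
  rewrite [X in mu X](_ : _ = [set x | Num.floor x = a + n%:Z]); last first.
    by apply/seteqP; split=> x [].
  rewrite slotE lebesgue_measure_itv /= lte_fin ltr_int ltrDl ltr01.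
  by rewrite -EFinB -intrB addrAC subrr add0r.
rewrite [X in mu X](_ : _ = set0) ?measure0 //.
by apply/seteqP; split=> x // [] /=; rewrite (negPf Bn).
Qed.

End Slots.

(** * Feasible schedules exclude overload *)

Section Cut.
Variables (R : realType) (I : instance) (k : nat) (s : schedule R I k).
Hypothesis s_feasible : feasible s.
Local Open Scope classical_set_scope.
Local Notation mu := (@lebesgue_measure R).

Lemma bigcup_ord {T : Type} n (F : 'I_n -> set T) :
  \bigcup_i F i = \big[setU/set0]_(i < n) F i.
Proof.
rewrite -bigcup_seq; apply: eq_bigcupl.
by split=> i //= _; rewrite mem_index_enum.
Qed.

(** On a fixed machine the jobs occupy disjoint parts of [A]; for a fixed job, its times on distinct
    machines are disjoint, so the double sum can be exchanged. *)
Lemma feasible_load (A : set (measurableTypeR R)) : measurable A ->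
  (\sum_(j < njobs I) mu ([set x | exists i, s i x = Some j] `&` A)
     <= \sum_(i < k) mu A)%E.
Proof.
move=> mA; have [ms s_inj _ _] := s_feasible.
pose F i j := [set x : measurableTypeR R | s i x = Some j] `&` A.
have mF i j : measurable (F i j) by exact: measurableI.
have -> : (\sum_(j < njobs I) mu ([set x | exists i, s i x = Some j] `&` A)
  = \sum_(j < njobs I) \sum_(i < k) mu (F i j))%E.
  apply: eq_bigr => j _; rewrite -measure_bigsetU_ord //; last first.
    by move=> i1 i2 _ _ [x [[+ _] [+ _]]]; exact: s_inj.
  rewrite -bigcup_ord; congr (mu _); apply/seteqP; split=> x.
    by move=> [[i xi] xA]; exists i.
  by move=> [i _ [xi xA]]; split=> //; exists i.
rewrite exchange_big; apply: lee_sum => i _.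
rewrite -measure_bigsetU_ord //; last first.
  by move=> j1 j2 _ _ [x [[/= + _] [/= + _]]]; move=> -> [].
apply: le_measure; rewrite ?inE //; first exact: bigsetU_measurable.
by rewrite -bigcup_ord => x [j _ []].
Qed.

Variable d : int.
Hypothesis deadline_d : forall j : 'I_(njobs I), deadline j = d.

Lemma feasible_cut T : ~ overload I k d T 0.
Proof.
apply/negP; rewrite -leqNgt.
set n := horizon I d; pose a := llf_start I.
pose A := [set x : measurableTypeR R | slots a n T (Num.floor x)].
have mA : measurable A by exact: measurable_floor_preimage.
have muA : mu A = ((\sum_(0 <= u < n) (T u : nat))%N%:R)%:E.
  exact: measure_slots.
have [ms _ s_window s_proc] := s_feasible.
pose E j := [set x : measurableTypeR R | exists i, s i x = Some j].
have mE j : measurable (E j).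
  have -> : E j = \bigcup_i [set x | s i x = Some j].
    by apply/seteqP; split=> x [i]; exists i.
  by rewrite bigcup_ord; exact: bigsetU_measurable.
have procE j : ((proc j - slots_outside d T 0 j)%N%:R%:E <= mu (E j `&` A))%E.
  have [le_po|lt_op] := leqP (proc j) (slots_outside d T 0 j).
    by rewrite (eqP le_po) measure_ge0.
  rewrite natrB 1?ltnW // EFinB leeBlDr // -s_proc.
  rewrite [leLHS](measureDI mu (mE j) mA) addeC leeD2l //.
  (* Outside [A], job [j] runs only in the slots counted by [slots_outside] or at the instant [d],
     which the closed window allows but which lies in no slot; it is a null set. *)
  pose W := slots a n (fun u => ~~ T u && (release j <= a + u%:Z)).
  pose B := [set x : measurableTypeR R | W (Num.floor x)].
  have mB : measurable B by exact: measurable_floor_preimage.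
  have m1 : measurable ([set d%:~R] : set (measurableTypeR R)).
    exact: measurable_set1.
  apply: (@le_trans _ _ (mu (B `|` [set d%:~R]))).
    apply: le_measure; rewrite ?inE; [exact: measurableD|exact: measurableU|].
    move=> x [[i /s_window]]; rewrite deadline_d => /andP[rx xd] nAx.
    have [->|x_neq_d] := eqVneq x d%:~R; [by right|left].
    have rf : release j <= Num.floor x by rewrite floor_ge_int.
    have fd : Num.floor x < d by rewrite floor_lt_int lt_neqAle x_neq_d.
    have aj := llf_start_le j.
    exists `|(Num.floor x - a)%R|%N.
    have fE : Num.floor x = a + `|(Num.floor x - a)%R|%N%:Z.
      by rewrite /a; lia.
    have un : (`|(Num.floor x - a)%R| < n)%N by rewrite /n /horizon /a; lia.
    split; rewrite -?fE ?rf ?andbT //; apply/negP => Tu; apply: nAx.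
    by exists `|(Num.floor x - a)%R|%N.
  apply: (le_trans (measureU2 _ mB m1)).
  by rewrite [X in (_ + X)%E]lebesgue_measure_set1 adde0 [leLHS]measure_slots.
rewrite -(ler_nat R) -lee_fin natr_sum natrM -sumEFin.
apply: (le_trans (lee_sum _ (fun j _ => procE j))).
apply: (le_trans (feasible_load mA)).
by rewrite muA sumEFin sumr_const card_ord mulr_natl.
Qed.

End Cut.

(** * Feasibility of the LLF schedule *)

Section LLFFeasible.
Variables (I : instance) (k : nat) (d : int).
Hypothesis deadline_d : forall j : 'I_(njobs I), deadline j = d.
Hypothesis cut : forall T, ~ overload I k d T 0.

(** Only jobs with work left are picked, so the truncated subtraction in [llf_iter] never loses a
    unit. *)
Lemma llf_iter_sum (j : 'I_(njobs I)) u :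
  (llf_iter k u j + \sum_(0 <= v < u)
     (j \in llf_pick k (llf_start I + v%:Z) (@llf_iter I k v) : nat))%N
  = proc j.
Proof.
elim: u => [|u IHu]; first by rewrite big_nil addn0.
rewrite big_nat_recr //= -{}IHu.
case: (boolP (j \in _)) => [/llf_pick_eligible/and3P[_ + _]|_] /=.
  by move=> rem_gt0; rewrite addn1 addnS -addSn subn1 prednK.
by rewrite subn0 addn0.
Qed.

(** A picked job is released, so [z] is not before the start; it has work left and nonnegative
    laxity, so [z] is before [d]. *)
Lemma llf_pick_slots z (j : 'I_(njobs I)) :
  j \in llf_pick k z (llf_rem k z) <->
  slots (llf_start I) (horizon I d)
    (fun u => j \in llf_pick k (llf_start I + u%:Z) (@llf_iter I k u)) z.
Proof.
have aj := llf_start_le j; split=> [jz|[u [_ ju ->]]]; last first.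
  by rewrite /llf_rem addrAC subrr add0r.
have /and3P[rj pj lax] := llf_pick_eligible jz.
have zE : z = llf_start I + `|(z - llf_start I)%R|%N%:Z by lia.
exists `|(z - llf_start I)%R|%N; split=> //; last first.
  by rewrite -zE; move: jz; rewrite {2}zE /llf_rem addrAC subrr add0r.
by move: lax pj; rewrite /laxity deadline_d /horizon; lia.
Qed.

Lemma llf_feasible (R : realType) : feasible (@llf_schedule I k R).
Proof.
have mem_pick i x j : @llf_schedule I k R i x = Some j ->
    j \in llf_pick k (Num.floor x) (llf_rem k (Num.floor x)).
  by move=> ij; apply/onthP; exists i.
split.
- move=> i j.
  exact: (measurable_floor_preimage
            (fun z => onth (llf_pick k z (llf_rem k z)) i = Some j)).
- move=> i1 i2 x j h1 h2; apply/ord_inj.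
  apply: (@onth_inj _ (llf_pick k (Num.floor x) (llf_rem k (Num.floor x)))).
  + exact: llf_pick_uniq.
  + by rewrite gtn_min -onthTE [X in isSome X]h2.
  + exact: etrans h1 (esym h2).
- move=> i x j /mem_pick/llf_pick_eligible/and3P[rj pj]; rewrite /laxity => lax.
  have fd : Num.floor x + 1 <= deadline j by move: pj lax; lia.
  have /andP[fx xf] := floor_itv x.
  apply/andP; split; first by apply: le_trans fx; rewrite ler_int.
  by apply: (le_trans (ltW xf)); rewrite ler_int; exact: fd.
(* No work is left at the horizon, so [proc j] is the number of slots in which [j] is picked. *)
move=> j; rewrite -[in RHS](llf_iter_sum j (horizon I d)).
rewrite (llf_iter_horizon deadline_d cut) add0n.
rewrite -[RHS](@measure_slots R (llf_start I)); congr (lebesgue_measure _).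
apply/seteqP; split=> x /=.
  by case=> i /mem_pick /llf_pick_slots.
move=> /llf_pick_slots /onthP[i ji].
pose q := llf_pick k (Num.floor x) (@llf_rem I k (Num.floor x)).
have iq : (i < size q)%N by rewrite -onthTE [X in isSome X]ji.
by exists (Ordinal (leq_trans iq (llf_pick_size _ _ _))).
Qed.

End LLFFeasible.

Theorem theorem14 (R : realType) (I : instance) (d : int) (m : nat) :
  (forall j : 'I_(njobs I), deadline j = d) ->
  optimal_machines R I m ->
  feasible (@llf_schedule I m R).
Proof.
move=> deadline_d [[s s_feasible] _].
exact: llf_feasible deadline_d (feasible_cut s_feasible deadline_d) R.
Qed.
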